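(* Let $\varphi:\mathbb{D}\to\mathbb{D}$ be a non-affine, non-automorphic linear fractional map that fixes the point $1$. Then, with $q=\varphi'(1)>0$ and some $d\in\mathbb{C}$ with $|d|>1$, $$\varphi(z)=\frac{(1+q+qd)z+(d-q-qd)}{z+d},$$ and, as an identity of power series in $x$ (with $|x|<q$), $$\sum_{k=0}^\infty \chi\big(\tau^{[k]}(\varphi(0))\big)\left[\prod_{m=0}^{k-1}\psi\big(\tau^{[m]}(\varphi(0))\big)\right]x^{k+1}=1-{}_2F_1(\alpha,\beta;\delta;x/q),$$ where $$\alpha=\frac{1+d}{qb|1+d|^2},\qquad \beta=\frac{d+d\bar d}{qb|1+d|^2},\qquad \delta=\frac{1}{qb},\qquad b=\frac{|d|^2-q|1+d|^2-1}{q|1+d|^2},$$ and $\psi,\chi,\tau$ are the auxiliary maps associated with $\varphi$.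
   Context: $\mathbb{D}=\{z\in\mathbb{C}:|z|<1\}$. A linear fractional map is $z\mapsto (Az+B)/(Cz+D)$ with $AD-BC\ne0$; it is affine if $C=0$; it is automorphic if it maps $\mathbb{D}$ bijectively onto $\mathbb{D}$. Writing $\varphi(z)=(Az+B)/(Cz+D)$ with $A=1+q+qd$, $B=d-q-qd$, $C=1$, $D=d$, the auxiliary maps are $$\sigma(z)=\frac{\bar A z-\bar C}{-\bar B z+\bar D},\quad \tau(z)=\varphi(\sigma(z)),\quad \psi(z)=\frac{(\overline{AD}-\overline{BC})z}{(\bar A z-\bar C)(-\bar B z+\bar D)},\quad \chi(z)=\frac{\bar C}{-\bar A z+\bar C}.$$ $\tau^{[k]}$ denotes the $k$-fold iterate of $\tau$ ($\tau^{[0]}$ is the identity), and an empty product equals $1$. The hypergeometric series is ${}_2F_1(a,b;c;z)=\sum_{k=0}^\infty\frac{(a)_k(b)_k}{(c)_k\,k!}z^k$ for $|z|<1$, where $(\zeta)_0=1$ and $(\zeta)_k=\zeta(\zeta+1)\cdots(\zeta+k-1)$ for $k\ge1$. *)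

(* Defs.v *)
From Stdlib Require Import Reals Factorial.
From Coquelicot Require Import Coquelicot.

Local Open Scope C_scope.

Definition disk (z : C) : Prop := (Cmod z < 1)%R.

(* Division by zero in [C] yields [0], so the pole is sent to [0].  This has no
   effect on the notions below: a linear fractional map with a pole in the
   closed disk is unbounded on [disk] and hence never maps [disk] into [disk]. *)
Definition lft (a b c d z : C) : C := (a * z + b) / (c * z + d).

Definition linear_fractional (phi : C -> C) : Prop :=
  exists a b c d : C, a * d - b * c <> 0 /\ forall z : C, phi z = lft a b c d z.

Definition affine (phi : C -> C) : Prop :=
  exists a b d : C, a * d - b * 0 <> 0 /\ forall z : C, phi z = lft a b 0 d z.

Definition disk_self_map (phi : C -> C) : Prop :=
  forall z : C, disk z -> disk (phi z).

Definition automorphic (phi : C -> C) : Prop :=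
  disk_self_map phi /\
  (forall z w : C, disk z -> disk w -> phi z = phi w -> z = w) /\
  (forall w : C, disk w -> exists z : C, disk z /\ phi z = w).

Section Auxiliary.

Variables a b c d : C.

Definition sigma (z : C) : C :=
  (Cconj a * z - Cconj c) / (- Cconj b * z + Cconj d).

Definition tau (z : C) : C := lft a b c d (sigma z).

Definition psi (z : C) : C :=
  ((Cconj (a * d) - Cconj (b * c)) * z) /
  ((Cconj a * z - Cconj c) * (- Cconj b * z + Cconj d)).

Definition chi (z : C) : C := Cconj c / (- Cconj a * z + Cconj c).

End Auxiliary.

(* [Cprod f n] is the product of [f m] over [m < n]. *)
Fixpoint Cprod (f : nat -> C) (n : nat) : C :=
  match n with
  | O => 1
  | S m => Cprod f m * f m
  end.

Definition poch (zeta : C) (k : nat) : C :=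
  Cprod (fun j => zeta + RtoC (INR j)) k.

(* [is_hyp2F1 a b c z l]: the hypergeometric series converges at [z], with
   sum [l]. *)
Definition is_hyp2F1 (a b c z l : C) : Prop :=
  is_series
    (fun k : nat =>
       (poch a k * poch b k) / (poch c k * RtoC (INR (fact k))) * z ^ k) l.

(* Main.v *)
Require Import Defs.
From Stdlib Require Import Reals Factorial Lia Lra Psatz.
From Coquelicot Require Import Coquelicot.
Local Open Scope C_scope.

(** Everything becomes affine in the coordinate [u = 1 / (1 - z)], which maps
    the disk onto the half-plane [Re u > 1/2] and sends the fixed point [1] to
    infinity ([disk_half_plane]).

    A non-affine linear fractional map fixing [1] has the form
    [(A z + B) / (z + d)] with [A + B = 1 + d], and in the coordinate [u] it is
    [u |-> p u - s] with [p = (1 + d) / (A - 1)] and [s = 1 / (A - 1)].  Such a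
    map sends the half-plane into itself only if [p] is a positive real and
    [Re p / 2 - Re s >= 1/2] ([affine_map_half_plane]).  With [q = 1 / p] this
    reads [A = 1 + q + q d] and [q |1 + d|^2 <= |d|^2 - 1]
    ([self_map_parameters]); hence [|d| > 1] and [b >= 0], and [b = 0] would
    make the map an automorphism ([boundary_case_automorphic]).  So [b > 0].

    Both [phi] and [sigma] are affine in [u], and their composite [tau] is the
    translation [u |-> u + b] ([tau_half_plane]).  The orbit of [phi 0] is
    therefore [u_k = b (beta + k)] ([orbit_half_plane]), and the factors of
    [psi] and [chi] are likewise arithmetic progressions:
    [psi (w_k) = (beta + k) (alpha + 1 + k) / (q (1 + k) (delta + 1 + k))] and
    [chi (w_k) = - (alpha / delta) (beta + k) / (q (1 + k))]
    ([psi_orbit], [chi_orbit]).  The products telescope into Pochhammer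
    symbols, so that the coefficient of [x^(k+1)] is minus the corresponding
    hypergeometric coefficient ([hypergeometric_coefficient]); the constant
    term [1] of the hypergeometric series accounts for the right-hand side
    [1 - F].  Convergence is the ratio test ([ex_hyp2F1]). *)

(** * Complex numbers and the half-plane coordinate *)

Lemma Cinv_0 : / RtoC 0 = RtoC 0.
Proof. unfold Cinv, RtoC; simpl; f_equal; unfold Rdiv; ring. Qed.

Lemma RtoC_neq_0 (x : R) : x <> 0%R -> RtoC x <> 0.
Proof. intros h e. apply h, RtoC_inj, e. Qed.

Lemma Cmod_lt_sqr (x y : C) : (Cmod x < Cmod y <-> Cmod x ^ 2 < Cmod y ^ 2)%R.
Proof.
  generalize (Cmod_ge_0 x) (Cmod_ge_0 y); intros; split; intro; nra.
Qed.

(** Valid also at the pole, where both sides are [0]. *)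
Lemma lft_normalize (a b c d z : C) :
  c <> 0 -> lft a b c d z = (a / c * z + b / c) / (z + d / c).
Proof.
  intro hc. unfold lft.
  destruct (Ceq_dec (c * z + d) 0) as [h | h].
  - assert (h' : z + d / c = 0).
    { replace (z + d / c) with ((c * z + d) / c) by (field; exact hc).
      rewrite h. field; exact hc. }
    rewrite h, h'. unfold Cdiv. rewrite Cinv_0. ring.
  - assert (h' : z * c + d <> 0) by (rewrite Cmult_comm; exact h).
    field. tauto.
Qed.

(** The disk is the half-plane [Re u > 1/2] in the coordinate
    [u = 1 / (1 - z)]: it is the condition [|u - 1| < |u|]. *)
Lemma disk_half_plane (u : C) : u <> 0 -> disk (1 - / u) <-> (1 / 2 < Re u)%R.
Proof.
  intro hu. unfold disk.
  replace (1 - / u) with ((u - 1) / u) by (field; exact hu).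
  rewrite Cmod_div by exact hu.
  assert (hp := proj1 (Cmod_gt_0 u) hu).
  rewrite <- (Rdiv_lt_1 (Cmod (u - 1)) (Cmod u)) by exact hp.
  rewrite Cmod_lt_sqr, !Cmod2_alt.
  destruct u as [x y]; simpl. split; intro; nra.
Qed.

(** * Normal form of a self-map of the disk fixing 1 *)

Lemma non_affine_normal_form (phi : C -> C) :
  linear_fractional phi -> ~ affine phi -> phi (RtoC 1) = RtoC 1 ->
  exists A B d : C,
    A * d - B <> 0 /\ A + B = 1 + d /\ 1 + d <> 0 /\
    forall z : C, phi z = (A * z + B) / (z + d).
Proof.
  intros [a [b [c [d [hdet hphi]]]]] hna hfix.
  assert (hc : c <> 0).
  { intro e. subst c. apply hna. exists a, b, d. split; assumption. }
  assert (h : forall z, phi z = (a / c * z + b / c) / (z + d / c)).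
  { intro z. rewrite hphi. apply lft_normalize, hc. }
  assert (hd : 1 + d / c <> 0).
  { intro e. rewrite h, e in hfix. unfold Cdiv in hfix.
    rewrite Cinv_0, Cmult_0_r in hfix. apply C1_nz. symmetry. exact hfix. }
  exists (a / c), (b / c), (d / c). split; [| split; [| split; assumption]].
  - intro e. apply hdet.
    replace (a * d - b * c) with ((a / c * (d / c) - b / c) * (c * c))
      by (field; exact hc).
    rewrite e. ring.
  - rewrite h, Cmult_1_r in hfix.
    transitivity ((a / c + b / c) / (1 + d / c) * (1 + d / c)).
    + unfold Cdiv at 3. rewrite <- Cmult_assoc, Cinv_l, Cmult_1_r by exact hd.
      reflexivity.
    + rewrite hfix. ring.
Qed.

(** An affine real function of two variables bounded below on a half-plane
    depends only on the first variable, and the bound persists on the boundary.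
    One horizontal line [y = y0] is exempted. *)
Lemma affine_real_lower_bound (p1 p2 s y0 : R) :
  (forall x y : R, 1 / 2 < x -> y <> y0 -> 1 / 2 < p1 * x - p2 * y - s)%R ->
  (p2 = 0 /\ 0 <= p1 /\ 1 / 2 <= p1 / 2 - s)%R.
Proof.
  intro h.
  assert (h2 : p2 = 0%R).
  { destruct (Req_dec p2 0) as [e | ne]; [exact e | exfalso].
    (* At [x = 1] the bound fails both for [y = (p1 - s) / p2] and for
       [y = (p1 - s + 1) / p2], and at least one of these differs from [y0]. *)
    destruct (Req_dec ((p1 - s) / p2) y0) as [e0 | ne0].
    - assert (k := h 1%R ((p1 - s + 1) / p2)%R ltac:(lra)).
      assert (ne1 : ((p1 - s + 1) / p2 <> y0)%R).
      { rewrite <- e0. intro e1. apply (f_equal (fun t => t * p2)%R) in e1.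
        field_simplify in e1; lra. }
      specialize (k ne1). field_simplify in k; lra.
    - assert (k := h 1%R _ ltac:(lra) ne0). field_simplify in k; lra. }
  subst p2.
  assert (h' : (forall x, 1 / 2 < x -> 1 / 2 < p1 * x - s)%R).
  { intros x hx. assert (k := h x (y0 + 1)%R hx ltac:(lra)). lra. }
  split; [reflexivity |]. split.
  - destruct (Rle_lt_dec 0 p1) as [l | l]; [exact l | exfalso].
    assert (k := h' (1 + Rabs (s / p1))%R
                    ltac:(generalize (Rabs_pos (s / p1)); lra)).
    assert (k2 := Rle_abs (s / p1)).
    assert (s = p1 * (s / p1))%R by (field; lra).
    nra.
  - destruct (Rle_lt_dec (1 / 2) (p1 / 2 - s)) as [l | l]; [exact l | exfalso].
    set (e := (1 / 2 - (p1 / 2 - s))%R).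
    assert (he : (0 < e)%R) by (unfold e; lra).
    assert (hp : (0 < Rabs p1 + 1)%R) by (generalize (Rabs_pos p1); lra).
    assert (hf : (0 < e / (2 * (Rabs p1 + 1)))%R)
      by (apply Rdiv_lt_0_compat; lra).
    assert (k := h' (1 / 2 + e / (2 * (Rabs p1 + 1)))%R ltac:(lra)).
    assert (k2 := Rle_abs p1).
    assert (e / 2 = (Rabs p1 + 1) * (e / (2 * (Rabs p1 + 1))))%R
      by (field; lra).
    unfold e in *. nra.
Qed.

(** The point [u = s / p] is exempted because it corresponds to the pole of the
    map in the coordinate [z], which is not yet known to lie outside the disk;
    the conclusion follows from the points off the horizontal line through it. *)
Lemma affine_map_half_plane (p s : C) :
  p <> 0 ->
  (forall u : C, (1 / 2 < Re u)%R -> p * u - s <> 0 -> (1 / 2 < Re (p * u - s))%R) ->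
  (Im p = 0 /\ 0 < Re p /\ 1 / 2 <= Re p / 2 - Re s)%R.
Proof.
  intros hp h.
  destruct (affine_real_lower_bound (Re p) (Im p) (Re s) (Im (s / p)))
    as [h1 [h2 h3]].
  - intros x y hx hy.
    assert (k : (1 / 2 < Re (p * (x, y) - s))%R).
    { apply h; [exact hx |]. intro e.
      apply hy. assert (e' : s / p = (x, y)).
      { replace s with (p * (x, y)).
        - field; exact hp.
        - replace (p * (x, y)) with ((p * (x, y) - s) + s) by ring.
          rewrite e. ring. }
      rewrite e'. reflexivity. }
    unfold Cminus in k. rewrite re_plus, re_opp, re_mult in k. simpl in k. lra.
  - split; [exact h1 |]. split; [| exact h3].
    destruct h2 as [h2 | h2]; [exact h2 |].
    exfalso; apply hp. rewrite (surjective_pairing p).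
    unfold RtoC. f_equal; [symmetry; exact h2 | exact h1].
Qed.

Lemma Re_inv (z : C) : (Re (/ z) = Re z / Cmod z ^ 2)%R.
Proof. rewrite Cmod2_alt. reflexivity. Qed.

(** The last inequality says that [b >= 0], and it implies [1 < Cmod d]. *)
Lemma self_map_parameters (A B d : C) :
  A * d - B <> 0 -> A + B = 1 + d -> 1 + d <> 0 ->
  disk_self_map (fun z => (A * z + B) / (z + d)) ->
  exists q : R,
    (0 < q)%R /\ A = 1 + q + q * d /\
    (q * Cmod (1 + d) ^ 2 <= Cmod d ^ 2 - 1)%R.
Proof.
  intros hdet hsum hd hself.
  assert (hB : B = 1 + d - A) by (rewrite <- hsum; ring).
  assert (hA : A - 1 <> 0).
  { intro e. apply hdet. rewrite hB. replace A with (A - 1 + 1) by ring.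
    rewrite e. ring. }
  destruct (affine_map_half_plane ((1 + d) / (A - 1)) (/ (A - 1)))
    as [him [hre hle]].
  - intro e. apply hd.
    replace (1 + d) with ((1 + d) / (A - 1) * (A - 1)) by (field; exact hA).
    rewrite e. ring.
  - intros u hu hne.
    assert (u0 : u <> 0).
    { intro e. rewrite e in hu. simpl in hu. lra. }
    (* [1 - / u] is not the pole [- d]. *)
    assert (hv : (1 + d) * u - 1 <> 0).
    { intro e. apply hne.
      replace ((1 + d) / (A - 1) * u - / (A - 1))
        with (((1 + d) * u - 1) / (A - 1)) by (field; exact hA).
      rewrite e. field; exact hA. }
    apply disk_half_plane; [exact hne |].
    replace (1 - / ((1 + d) / (A - 1) * u - / (A - 1)))
      with ((A * (1 - / u) + B) / (1 - / u + d)).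
    + apply hself. apply disk_half_plane; assumption.
    + rewrite hB. field. repeat split; assumption.
  - set (p := (1 + d) / (A - 1)) in *.
    assert (hp : p = RtoC (Re p)).
    { rewrite (surjective_pairing p) at 1. unfold RtoC. f_equal. exact him. }
    assert (p0 : RtoC (Re p) <> 0) by (apply RtoC_neq_0; lra).
    exists (/ Re p)%R. split; [apply Rinv_0_lt_compat; exact hre |].
    assert (hA1 : A - 1 = / RtoC (Re p) * (1 + d)).
    { rewrite <- hp. unfold p. field. split; assumption. }
    split.
    + rewrite RtoC_inv by lra.
      replace A with (A - 1 + 1) by ring. rewrite hA1. ring.
    + assert (hs : / (A - 1) = RtoC (Re p) * / (1 + d)).
      { rewrite hA1. field. split; assumption. }
      rewrite hs, re_scal_l, Re_inv in hle.
      assert (hN : (0 < Cmod (1 + d) ^ 2)%R)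
        by (apply pow_lt, Cmod_gt_0; exact hd).
      assert (e : (Cmod (1 + d) ^ 2 = 2 * Re (1 + d) + Cmod d ^ 2 - 1)%R).
      { rewrite !Cmod2_alt. destruct d as [x y]; simpl. ring. }
      set (N := (Cmod (1 + d) ^ 2)%R) in *.
      assert (hq : (0 < / Re p)%R) by (apply Rinv_0_lt_compat; exact hre).
      assert (h2 : (2 * N * / Re p * (1 / 2) <=
                    2 * N * / Re p * (Re p / 2 - Re p * (Re (1 + d) / N)))%R).
      { apply Rmult_le_compat_l; [| exact hle].
        apply Rmult_le_pos; lra. }
      replace (2 * N * / Re p * (Re p / 2 - Re p * (Re (1 + d) / N)))%R
        with (N - 2 * Re (1 + d))%R in h2 by (field; lra).
      lra.
Qed.

(** The remainder [phi z - phi 1 - q (z - 1)] is [- q (z - 1)^2 / (z + d)]. *)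
Lemma is_derive_normal_form (phi : C -> C) (q : R) (d : C) :
  (0 < q)%R -> 1 + d <> 0 ->
  (forall z : C, phi z = ((1 + q + q * d) * z + (d - q - q * d)) / (z + d)) ->
  is_derive phi (RtoC 1) (RtoC q).
Proof.
  intros hq hd hphi. split.
  - apply (is_linear_scal_l (K := C_AbsRing) (V := C_NormedModule)).
  - intros x hx.
    apply (is_filter_lim_locally_unique (K := C_AbsRing)
             (V := AbsRing_NormedModule C_AbsRing)) in hx. subst x.
    intros [eps heps]. simpl.
    assert (hm := proj1 (Cmod_gt_0 _) hd).
    set (m := Cmod (1 + d)) in *.
    assert (hr : (0 < Rmin (m / 2) (eps * m / (2 * q)))%R).
    { apply Rmin_glb_lt; [lra |]. apply Rdiv_lt_0_compat; nra. }
    exists (mkposreal _ hr). intros z hz.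
    change (Cmod (z - 1) < Rmin (m / 2) (eps * m / (2 * q)))%R in hz.
    change (Cmod (phi z - phi 1 - (z - 1) * q) <= eps * Cmod (z - 1))%R.
    assert (hz1 := Rlt_le_trans _ _ _ hz (Rmin_l _ _)).
    assert (hz2 := Rlt_le_trans _ _ _ hz (Rmin_r _ _)).
    assert (hzd : (m / 2 < Cmod (z + d))%R).
    { assert (k := Cmod_triangle (z + d) (- (z - 1))).
      replace (z + d + - (z - 1)) with (1 + d) in k by ring.
      rewrite Cmod_opp in k. fold m in k. lra. }
    assert (hzd0 : z + d <> 0) by (apply Cmod_gt_0; lra).
    replace (phi z - phi 1 - (z - 1) * q)
      with ((z - 1) * (- (q * (z - 1) / (z + d)))).
    2: { rewrite !hphi. field. split; assumption. }
    rewrite Cmod_mult, Cmod_opp, Cmod_div, Cmod_mult, Cmod_R, Rabs_pos_eq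
      by (assumption || lra).
    rewrite Rmult_comm. apply Rmult_le_compat_r; [apply Cmod_ge_0 |].
    apply Rle_div_l; [lra |].
    assert (q * Cmod (z - 1) <= q * (eps * m / (2 * q)))%R
      by (apply Rmult_le_compat_l; lra).
    replace (q * (eps * m / (2 * q)))%R with (eps * (m / 2))%R in H
      by (field; lra).
    nra.
Qed.

Lemma plus_neq_0_of_Cmod_lt (z d : C) : (Cmod z < Cmod d)%R -> z + d <> 0.
Proof.
  intros h e.
  assert (e' : d = - z).
  { replace d with (z + d - z) by ring. rewrite e. ring. }
  rewrite e', Cmod_opp in h. lra.
Qed.

(** In the coordinate [u] the map is [u |-> u / q - 1 / (q (1 + d))]; when
    [q |1 + d|^2 = |d|^2 - 1] it maps the line [Re u = 1/2] to itself, so it is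
    onto the half-plane. *)
Lemma boundary_case_automorphic (phi : C -> C) (q : R) (d : C) :
  (0 < q)%R -> (1 < Cmod d)%R ->
  (forall z : C, phi z = ((1 + q + q * d) * z + (d - q - q * d)) / (z + d)) ->
  disk_self_map phi ->
  (Cmod d ^ 2 - 1 = q * Cmod (1 + d) ^ 2)%R ->
  automorphic phi.
Proof.
  intros hq hd hphi hself hbd.
  assert (hpole : forall z, disk z -> z + d <> 0).
  { intros z hz. apply plus_neq_0_of_Cmod_lt. unfold disk in hz. lra. }
  assert (hd1 : 1 + d <> 0).
  { apply plus_neq_0_of_Cmod_lt. rewrite Cmod_1. exact hd. }
  assert (q0 : RtoC q <> 0) by (apply RtoC_neq_0; lra).
  split; [exact hself |]. split.
  - intros z w hz hw e.
    assert (ez := hpole z hz). assert (ew := hpole w hw).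
    apply Ceq_minus.
    assert (k : phi z - phi w
                = q * (1 + d) * (1 + d) * (z - w) / ((z + d) * (w + d))).
    { rewrite !hphi. field. split; assumption. }
    replace (z - w)
      with ((phi z - phi w) * ((z + d) * (w + d)) / (q * (1 + d) * (1 + d))).
    + rewrite e. field. split; assumption.
    + rewrite k. field. repeat split; assumption.
  - intros w hw.
    assert (w1 : 1 - w <> 0).
    { intro e. unfold disk in hw.
      replace w with (1 - (1 - w)) in hw by ring. rewrite e in hw.
      replace (1 - 0) with (RtoC 1) in hw by ring. rewrite Cmod_1 in hw. lra. }
    set (v := / (1 - w)).
    assert (v0 : v <> 0).
    { intro e. apply C1_nz. replace (RtoC 1) with ((1 - w) * v).
      - rewrite e. ring.
      - unfold v. field. exact w1. }
    assert (ew : w = 1 - / v) by (unfold v; field; exact w1).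
    assert (hv : (1 / 2 < Re v)%R).
    { apply disk_half_plane; [exact v0 |]. rewrite <- ew. exact hw. }
    (* The solution of [u / q - 1 / (q (1 + d)) = v]. *)
    set (u := q * v + / (1 + d)).
    assert (hu : (1 / 2 < Re u)%R).
    { unfold u. rewrite re_plus, re_scal_l, Re_inv.
      assert (hN : (0 < Cmod (1 + d) ^ 2)%R)
        by (apply pow_lt, Cmod_gt_0; exact hd1).
      assert (e : (Cmod (1 + d) ^ 2 = 2 * Re (1 + d) + Cmod d ^ 2 - 1)%R).
      { rewrite !Cmod2_alt. destruct d as [x y]; simpl. ring. }
      set (N := (Cmod (1 + d) ^ 2)%R) in *.
      assert (Re (1 + d) / N = 1 / 2 - q / 2)%R.
      { apply (Rmult_eq_reg_r N); [| lra].
        replace (Re (1 + d) / N * N)%R with (Re (1 + d)) by (field; lra). lra. }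
      rewrite H. nra. }
    assert (u0 : u <> 0).
    { intro e. rewrite e in hu. simpl in hu. lra. }
    exists (1 - / u).
    assert (hz : disk (1 - / u)) by (apply disk_half_plane; assumption).
    split; [exact hz |].
    assert (hz' := hpole _ hz).
    rewrite hphi, ew.
    assert (hu' : q * v * (1 + d) + 1 <> 0).
    { intro e. apply u0. unfold u.
      replace (q * v + / (1 + d)) with ((q * v * (1 + d) + 1) / (1 + d))
        by (field; exact hd1).
      rewrite e. field. exact hd1. }
    assert (hz2 : 1 - / u + d = q * v * (1 + d) / u).
    { unfold u. field. split; assumption. }
    rewrite hz2. unfold u. field. repeat split; assumption.
Qed.

(** * The hypergeometric series *)

(** A ratio test that allows vanishing terms, as occur when a numerator
    parameter is a nonpositive integer. *)
Lemma ex_series_ratio (t : nat -> C) (r : R) (K : nat) :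
  (0 <= r < 1)%R ->
  (forall k, (K <= k)%nat -> (Cmod (t (S k)) <= r * Cmod (t k))%R) ->
  ex_series (K := C_AbsRing) (V := C_NormedModule) t.
Proof.
  intros hr h.
  apply (ex_series_incr_n (K := C_AbsRing) (V := C_NormedModule) t K).
  apply (ex_series_le (K := C_AbsRing) (V := C_CompleteNormedModule)
           _ (fun n => scal (Cmod (t K)) (r ^ n)%R)).
  - intro n. change (Cmod (t (K + n)%nat) <= Cmod (t K) * r ^ n)%R.
    induction n as [| n IH].
    + rewrite Nat.add_0_r. simpl. lra.
    + rewrite Nat.add_succ_r.
      eapply Rle_trans; [apply h; lia |]. simpl.
      replace (Cmod (t K) * (r * r ^ n))%R with (r * (Cmod (t K) * r ^ n))%R
        by ring.
      apply Rmult_le_compat_l; [lra | exact IH].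
  - apply (ex_series_scal (K := R_AbsRing) (V := R_NormedModule)), ex_series_geom.
    rewrite Rabs_pos_eq; lra.
Qed.

Lemma poch_S (a : C) (k : nat) : poch a (S k) = poch a k * (a + RtoC (INR k)).
Proof. reflexivity. Qed.

Lemma pos_plus_INR_neq_0 (c : R) (k : nat) :
  (0 < c)%R -> RtoC c + RtoC (INR k) <> 0.
Proof.
  intro hc. rewrite <- RtoC_plus. apply RtoC_neq_0.
  generalize (pos_INR k). lra.
Qed.

Lemma poch_neq_0 (c : R) (k : nat) : (0 < c)%R -> poch c k <> 0.
Proof.
  intro hc. induction k as [| k IH]; [exact C1_nz |].
  rewrite poch_S. apply Cmult_neq_0; [exact IH |].
  apply pos_plus_INR_neq_0; exact hc.
Qed.

Lemma RtoC_fact_neq_0 (k : nat) : RtoC (INR (fact k)) <> 0.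
Proof. apply RtoC_neq_0, INR_fact_neq_0. Qed.

Lemma RtoC_fact_S (k : nat) :
  RtoC (INR (fact (S k))) = RtoC (INR (fact k)) * (1 + RtoC (INR k)).
Proof.
  rewrite fact_simpl, mult_INR, S_INR, RtoC_mult, RtoC_plus. ring.
Qed.

(** The [k]-th term of the hypergeometric series. *)
Definition hyp_term (a b c z : C) (k : nat) : C :=
  (poch a k * poch b k) / (poch c k * RtoC (INR (fact k))) * z ^ k.

Lemma hyp_term_S (a b : C) (c : R) (z : C) (k : nat) :
  (0 < c)%R ->
  hyp_term a b c z (S k)
  = (a + INR k) * (b + INR k) / ((c + INR k) * (1 + INR k)) * z
    * hyp_term a b c z k.
Proof.
  intro hc. unfold hyp_term. rewrite !poch_S, RtoC_fact_S. simpl (z ^ S k).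
  assert (h1 := pos_plus_INR_neq_0 1 k Rlt_0_1).
  assert (h2 := pos_plus_INR_neq_0 c k hc).
  assert (h3 := RtoC_fact_neq_0 k). assert (h4 := poch_neq_0 c k hc).
  field. repeat split; assumption.
Qed.

(** With [M = |a| + |b|], the ratio of consecutive terms is at most
    [(1 + M / k)^2 |z|], which is eventually at most [(1 + |z|) / 2 < 1]. *)
Lemma ex_hyp2F1 (a b : C) (c : R) (z : C) :
  (0 < c)%R -> (Cmod z < 1)%R -> exists l : C, is_hyp2F1 a b c z l.
Proof.
  intros hc hz.
  set (s := Cmod z) in *. assert (hs : (0 <= s)%R) by apply Cmod_ge_0.
  set (M := (Cmod a + Cmod b)%R).
  assert (ha := Cmod_ge_0 a). assert (hb := Cmod_ge_0 b).
  set (E := (2 * M + M * M)%R).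
  assert (hE : (0 <= E)%R) by (unfold E, M; nra).
  assert (hlim : exists K : nat, (1 <= INR K)%R /\ (2 * E / (1 - s) <= INR K)%R).
  { destruct (INR_unbounded (1 + 2 * E / (1 - s))) as [K hK].
    exists K. assert (0 <= 2 * E / (1 - s))%R by (apply Rle_div_r; lra). lra. }
  destruct hlim as [K [hK1 hK2]].
  apply (ex_series_ratio (hyp_term a b c z) ((1 + s) / 2) K); [lra |].
  intros k hk. apply le_INR in hk.
  rewrite hyp_term_S by exact hc. rewrite Cmod_mult.
  apply Rmult_le_compat_r; [apply Cmod_ge_0 |].
  set (n := INR k) in *.
  rewrite Cmod_mult, Cmod_div.
  2: { apply Cmult_neq_0; apply pos_plus_INR_neq_0; [exact hc | apply Rlt_0_1]. }
  rewrite !Cmod_mult, <- !RtoC_plus, !Cmod_R, !Rabs_pos_eq by lra.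
  fold s.
  assert (h1 : (Cmod (a + n) <= n + M)%R).
  { eapply Rle_trans; [apply Cmod_triangle |].
    rewrite Cmod_R, Rabs_pos_eq by lra. unfold M. lra. }
  assert (h2 : (Cmod (b + n) <= n + M)%R).
  { eapply Rle_trans; [apply Cmod_triangle |].
    rewrite Cmod_R, Rabs_pos_eq by lra. unfold M. lra. }
  assert (hM : (0 <= M)%R) by (unfold M; lra).
  assert (h3 : (Cmod (a + n) * Cmod (b + n) <= (n + M) * (n + M))%R).
  { apply Rmult_le_compat; auto using Cmod_ge_0. }
  assert (h4 : (s * ((n + M) * (n + M)) <= (1 + s) / 2 * (n * n))%R).
  { assert (2 * E <= n * (1 - s))%R.
    { apply Rle_div_l; lra. }
    assert (M * M <= M * M * n)%R by nra.
    assert ((n + M) * (n + M) <= n * n + E * n)%R by (unfold E; nra).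
    assert (s * ((n + M) * (n + M)) <= s * (n * n + E * n))%R
      by (apply Rmult_le_compat_l; lra).
    assert (s * (E * n) <= (1 - s) / 2 * (n * n))%R.
    { assert (s * (E * n) <= E * n)%R by nra. nra. }
    nra. }
  replace (Cmod (a + n) * Cmod (b + n) / ((c + n) * (1 + n)) * s)%R
    with (s * (Cmod (a + n) * Cmod (b + n)) / ((c + n) * (1 + n)))%R
    by (field; lra).
  apply Rle_div_l; [nra |].
  eapply Rle_trans; [apply Rmult_le_compat_l; [exact hs | exact h3] |].
  eapply Rle_trans; [exact h4 |].
  apply Rmult_le_compat_l; nra.
Qed.

(** The factor [alpha / delta] turns the products of [alpha + 1 + m] and
    [delta + 1 + m] over [m < k] into the Pochhammer symbols of order [k + 1] of
    [alpha] and [delta]. *)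
Lemma Cprod_hypergeometric (alpha beta : C) (delta q : R) (P : nat -> C) :
  (0 < delta)%R -> (0 < q)%R ->
  (forall m, P m = / q * ((beta + INR m) * (alpha + 1 + INR m))
                   / ((1 + INR m) * (delta + 1 + INR m))) ->
  forall k,
    alpha / delta * Cprod P k
    = poch alpha (S k) * poch beta k
      / (poch delta (S k) * INR (fact k) * q ^ k).
Proof.
  intros hdelta hq hP k.
  assert (q0 : RtoC q <> 0) by (apply RtoC_neq_0; lra).
  assert (d0 : RtoC delta <> 0) by (apply RtoC_neq_0; lra).
  induction k as [| k IH].
  - rewrite !poch_S. simpl. unfold poch; simpl. field. exact d0.
  - simpl (Cprod P (S k)). rewrite Cmult_assoc, IH, hP.
    rewrite (poch_S _ (S k)), (poch_S delta (S k)), (poch_S beta).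
    rewrite RtoC_fact_S, S_INR, RtoC_plus. simpl (RtoC q ^ S k).
    field.
    assert (h1 := pos_plus_INR_neq_0 1 k Rlt_0_1).
    assert (h2 : delta + 1 + INR k <> 0).
    { rewrite <- RtoC_plus. apply pos_plus_INR_neq_0. lra. }
    assert (h3 : delta + (INR k + 1) <> 0).
    { intro e. apply h2. rewrite <- e. ring. }
    repeat split; try assumption; try apply Cpow_nz; try assumption;
      try apply RtoC_fact_neq_0; try (apply poch_neq_0; assumption).
Qed.

Lemma hypergeometric_coefficient (alpha beta : C) (delta q : R) (P : nat -> C)
  (x : C) (k : nat) :
  (0 < delta)%R -> (0 < q)%R ->
  (forall m, P m = / q * ((beta + INR m) * (alpha + 1 + INR m))
                   / ((1 + INR m) * (delta + 1 + INR m))) ->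
  - (alpha / delta * (beta + INR k) / (q * (1 + INR k))) * Cprod P k * x ^ S k
  = - hyp_term alpha beta delta (x / q) (S k).
Proof.
  intros hdelta hq hP.
  assert (q0 : RtoC q <> 0) by (apply RtoC_neq_0; lra).
  assert (h := Cprod_hypergeometric alpha beta delta q P hdelta hq hP k).
  assert (h1 := pos_plus_INR_neq_0 1 k Rlt_0_1).
  assert (hd := poch_neq_0 delta (S k) hdelta).
  assert (hf := RtoC_fact_neq_0 k).
  assert (hqk := Cpow_nz q k q0).
  replace (- (alpha / delta * (beta + INR k) / (q * (1 + INR k))) * Cprod P k
           * x ^ S k)
    with (- ((alpha / delta * Cprod P k) * (beta + INR k) / (q * (1 + INR k))
             * x ^ S k)).
  2: { unfold Cdiv. ring. }
  rewrite h. unfold hyp_term, Cdiv at 4.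
  rewrite Cpow_mult_l, Cpow_inv by exact q0.
  rewrite (poch_S beta k), RtoC_fact_S.
  simpl (RtoC q ^ S k). field. repeat split; assumption.
Qed.

(** * The auxiliary maps in the half-plane coordinate *)

Lemma Cconj_RtoC (x : R) : Cconj (RtoC x) = RtoC x.
Proof. unfold Cconj, RtoC; simpl; f_equal; ring. Qed.

Lemma Cconj_neq_0 (z : C) : z <> 0 -> Cconj z <> 0.
Proof.
  intros h e. apply h. rewrite <- (Cconj_conj z), e. apply Cconj_RtoC.
Qed.

Lemma one_plus_Cconj_neq_0 (d : C) : 1 + d <> 0 -> 1 + Cconj d <> 0.
Proof.
  intro h. apply Cconj_neq_0 in h. rewrite Cplus_conj, Cconj_RtoC in h. exact h.
Qed.

Lemma normal_form_half_plane (q : R) (d v : C) :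
  RtoC q <> 0 -> 1 + d <> 0 -> v <> 0 -> v / q - / (q * (1 + d)) <> 0 ->
  lft (1 + q + q * d) (d - q - q * d) 1 d (1 - / v)
  = 1 - / (v / q - / (q * (1 + d))).
Proof.
  intros hq hd hv hu. unfold lft.
  assert (h : v * (1 + d) - 1 <> 0).
  { intro e. apply hu.
    replace (v / q - / (q * (1 + d))) with ((v * (1 + d) - 1) / (q * (1 + d)))
      by (field; split; assumption).
    rewrite e. field. split; assumption. }
  field. repeat split; assumption.
Qed.

Section HalfPlane.

Variables (q : R) (d u : C).
Let A : C := 1 + q + q * d.
Let B : C := d - q - q * d.
Let e : C := Cconj d.

Hypothesis hq : RtoC q <> 0.
Hypothesis hd : 1 + d <> 0.
Hypothesis hu : u <> 0.

Lemma Cconj_A : Cconj A = 1 + q + q * e.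
Proof. unfold A. rewrite !Cplus_conj, Cmult_conj, !Cconj_RtoC. reflexivity. Qed.

Lemma Cconj_B : Cconj B = e - q - q * e.
Proof. unfold B. rewrite !Cminus_conj, Cmult_conj, !Cconj_RtoC. reflexivity. Qed.

(* [Defs.sigma] is qualified because [sigma] also names the finite sums of
   real numbers. *)
Lemma sigma_half_plane :
  u - 1 + e / (q * (1 + e)) <> 0 ->
  Defs.sigma A B 1 d (1 - / u) = 1 - / (q * (u - 1 + e / (q * (1 + e)))).
Proof.
  intro hv. assert (he := one_plus_Cconj_neq_0 d hd). fold e in he.
  unfold Defs.sigma. rewrite Cconj_A, Cconj_B, Cconj_RtoC. fold e.
  assert (hv' : q * (u - 1) * (1 + e) + e <> 0).
  { intro h. apply hv.
    replace (u - 1 + e / (q * (1 + e)))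
      with ((q * (u - 1) * (1 + e) + e) / (q * (1 + e)))
      by (field; split; assumption).
    rewrite h. field; split; assumption. }
  replace (u - 1 + e / (q * (1 + e)))
    with ((q * (u - 1) * (1 + e) + e) / (q * (1 + e)))
    by (field; split; assumption).
  replace (- (e - q - q * e) * (1 - / u) + e)
    with ((q * (u - 1) * (1 + e) + e) / u) by (field; exact hu).
  field. repeat split; assumption.
Qed.

(** [tau] is parabolic: the multipliers of [phi] and [sigma] at [1] are [q] and
    [1 / q], so their composite is a translation. *)
Lemma tau_half_plane (b : C) :
  b = (d * e - 1) / (q * ((1 + d) * (1 + e))) - 1 ->
  u - 1 + e / (q * (1 + e)) <> 0 -> u + b <> 0 ->
  tau A B 1 d (1 - / u) = 1 - / (u + b).
Proof.
  intros hb hv hub. assert (he := one_plus_Cconj_neq_0 d hd). fold e in he.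
  unfold tau. rewrite sigma_half_plane by exact hv.
  assert (k : u + b = q * (u - 1 + e / (q * (1 + e))) / q - / (q * (1 + d))).
  { rewrite hb. field. repeat split; assumption. }
  unfold A, B. rewrite normal_form_half_plane; try assumption.
  - rewrite k. reflexivity.
  - apply Cmult_neq_0; assumption.
  - rewrite <- k. exact hub.
Qed.

Lemma psi_half_plane :
  u - 1 - / (q * (1 + e)) <> 0 -> u - 1 + e / (q * (1 + e)) <> 0 ->
  psi A B 1 d (1 - / u)
  = / q * (u * (u - 1))
    / ((u - 1 - / (q * (1 + e))) * (u - 1 + e / (q * (1 + e)))).
Proof.
  intros h1 h2. assert (he := one_plus_Cconj_neq_0 d hd). fold e in he.
  unfold psi. rewrite !Cmult_conj, Cconj_A, Cconj_B, Cconj_RtoC. fold e.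
  set (f := u - 1 - / (q * (1 + e))) in *.
  set (g := u - 1 + e / (q * (1 + e))) in *.
  replace ((1 + q + q * e) * (1 - / u) - 1) with (q * (1 + e) * f / u).
  2: { unfold f. field. repeat split; assumption. }
  replace (- (e - q - q * e) * (1 - / u) + e) with (q * (1 + e) * g / u).
  2: { unfold g. field. repeat split; assumption. }
  field. repeat split; assumption.
Qed.

Lemma chi_half_plane :
  u - 1 - / (q * (1 + e)) <> 0 ->
  chi A 1 (1 - / u) = - (u / (q * (1 + e) * (u - 1 - / (q * (1 + e))))).
Proof.
  intro h1. assert (he := one_plus_Cconj_neq_0 d hd). fold e in he.
  unfold chi. rewrite Cconj_A, Cconj_RtoC.
  set (f := u - 1 - / (q * (1 + e))) in *.
  replace (- (1 + q + q * e) * (1 - / u) + 1) with (- (q * (1 + e) * f / u)).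
  2: { unfold f. field. repeat split; assumption. }
  field. repeat split; try assumption.
Qed.

End HalfPlane.

(** * The orbit of phi(0) and the series *)

Section Orbit.

Variables (q : R) (d : C).
Hypothesis hq : (0 < q)%R.
Hypothesis hd : (1 < Cmod d)%R.
Let A : C := 1 + q + q * d.
Let B : C := d - q - q * d.
Let N : R := (Cmod (1 + d) ^ 2)%R.
Let b : R := ((Cmod d ^ 2 - q * N - 1) / (q * N))%R.
Hypothesis hb : (0 < b)%R.
Let alpha : C := (1 + d) / RtoC (q * b * N)%R.
Let beta : C := (d + d * Cconj d) / RtoC (q * b * N)%R.
Let delta : R := (1 / (q * b))%R.
Let e : C := Cconj d.
Let w (k : nat) : C := Nat.iter k (tau A B 1 d) (lft A B 1 d 0).
(** The coordinate of [w k]. *)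
Let u (k : nat) : C := RtoC b * (beta + INR k).

Let q0 : RtoC q <> 0. Proof. apply RtoC_neq_0; lra. Qed.
Let b0 : RtoC b <> 0. Proof. apply RtoC_neq_0; lra. Qed.
Let d1 : 1 + d <> 0.
Proof. apply plus_neq_0_of_Cmod_lt. rewrite Cmod_1. exact hd. Qed.
Let e1 : 1 + e <> 0. Proof. apply one_plus_Cconj_neq_0, d1. Qed.
Let N_pos : (0 < N)%R. Proof. apply pow_lt, Cmod_gt_0, d1. Qed.
Let delta_pos : (0 < delta)%R.
Proof. apply Rdiv_lt_0_compat; [lra | nra]. Qed.

Let RtoC_N : RtoC N = (1 + d) * (1 + e).
Proof. unfold N. rewrite Cmod2_conj, Cplus_conj, Cconj_RtoC. reflexivity. Qed.

Let RtoC_b : RtoC b = (d * e - 1) / (q * ((1 + d) * (1 + e))) - 1.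
Proof.
  unfold b.
  rewrite RtoC_div, !RtoC_minus, !RtoC_mult, RtoC_N, Cmod2_conj by nra.
  fold e. field. repeat split; assumption.
Qed.

Let RtoC_qbN : RtoC (q * b * N)%R = q * b * ((1 + d) * (1 + e)).
Proof. rewrite !RtoC_mult, RtoC_N. reflexivity. Qed.

Let RtoC_delta : RtoC delta = / (q * b).
Proof. unfold delta. rewrite RtoC_div, RtoC_mult by nra. field. split; assumption. Qed.

Let u_0 : u 0 = 1 / q - / (q * (1 + d)).
Proof.
  unfold u, beta. rewrite RtoC_qbN. fold e. simpl (INR 0). field.
  repeat split; assumption.
Qed.

Let u_S (k : nat) : u (S k) = u k + b.
Proof. unfold u. rewrite S_INR, RtoC_plus. ring. Qed.

Let u_minus_1 (k : nat) : u k - 1 = RtoC b * (alpha + 1 + INR k).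
Proof.
  replace (u k - 1) with (u 0 - 1 + b * INR k).
  2: { unfold u. simpl (INR 0). ring. }
  rewrite u_0. unfold alpha. rewrite RtoC_qbN.
  replace (RtoC b * ((1 + d) / (q * b * ((1 + d) * (1 + e))) + 1 + INR k))
    with (/ (q * (1 + e)) + b + b * INR k)
    by (field; repeat split; assumption).
  rewrite RtoC_b at 2. field. repeat split; assumption.
Qed.

Let u_minus_1_minus (k : nat) :
  u k - 1 - / (q * (1 + e)) = RtoC b * (1 + INR k).
Proof.
  rewrite u_minus_1. unfold alpha. rewrite RtoC_qbN. field.
  repeat split; assumption.
Qed.

Let u_minus_1_plus (k : nat) :
  u k - 1 + e / (q * (1 + e)) = RtoC b * (delta + 1 + INR k).
Proof.
  rewrite u_minus_1, RtoC_delta. unfold alpha. rewrite RtoC_qbN. field.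
  repeat split; assumption.
Qed.

(** The real part is positive because [Re (d / (1 + d)) > 0] for [|d| > 1]. *)
Let u_neq_0 (k : nat) : u k <> 0.
Proof.
  assert (h : (0 < Re (u k))%R).
  { replace (u k) with (RtoC (/ q) * (1 - / (1 + d)) + RtoC (b * INR k)).
    - unfold Cminus. rewrite re_plus, re_scal_l, re_plus, re_opp, Re_inv.
      fold N. simpl (Re (RtoC _)).
      assert (h1 : (0 < / q)%R) by (apply Rinv_0_lt_compat; exact hq).
      assert (h2 : (0 <= b * INR k)%R)
        by (apply Rmult_le_pos; [lra | apply pos_INR]).
      assert (h3 : (0 < 1 - Re (1 + d) / N)%R).
      { replace (1 - Re (1 + d) / N)%R with ((N - Re (1 + d)) / N)%R
          by (field; lra).
        apply Rdiv_lt_0_compat; [| exact N_pos].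
        assert (h4 := re_le_Cmod d). assert (h5 := Rcomplements.Rabs_maj2 (Re d)).
        assert (h6 : (Cmod d < Cmod d ^ 2)%R) by nra.
        assert (h7 : (N - Re (1 + d) = Cmod d ^ 2 + Re d)%R).
        { unfold N. rewrite !Cmod2_alt. destruct d as [x y]; simpl. ring. }
        lra. }
      nra.
    - rewrite RtoC_mult, RtoC_inv by lra.
      transitivity (u 0 + b * INR k).
      + rewrite u_0. field. split; assumption.
      + unfold u. simpl (INR 0). ring. }
  intro h0. rewrite h0 in h. simpl in h. lra.
Qed.

Let one_plus_INR_neq_0 (k : nat) : 1 + RtoC (INR k) <> 0.
Proof. apply pos_plus_INR_neq_0, Rlt_0_1. Qed.

Let delta_plus_neq_0 (k : nat) : delta + 1 + RtoC (INR k) <> 0.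
Proof. rewrite <- RtoC_plus. apply pos_plus_INR_neq_0. lra. Qed.

Lemma orbit_half_plane (k : nat) : w k = 1 - / u k.
Proof.
  induction k as [| k IH].
  - unfold w. simpl Nat.iter. rewrite u_0.
    (* The point [0] has coordinate [1]. *)
    replace (RtoC 0) with (1 - / 1) by field.
    apply normal_form_half_plane; [exact q0 | exact d1 | exact C1_nz |].
    rewrite <- u_0. apply u_neq_0.
  - change (w (S k)) with (tau A B 1 d (w k)). rewrite IH, u_S.
    apply tau_half_plane; try assumption.
    + apply u_neq_0.
    + fold e. rewrite u_minus_1_plus. apply Cmult_neq_0; auto.
    + rewrite <- u_S. apply u_neq_0.
Qed.

Lemma psi_orbit (k : nat) :
  psi A B 1 d (w k)
  = / q * ((beta + INR k) * (alpha + 1 + INR k))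
    / ((1 + INR k) * (delta + 1 + INR k)).
Proof.
  rewrite orbit_half_plane. unfold A, B. rewrite psi_half_plane; try assumption.
  - fold e. rewrite u_minus_1_minus, u_minus_1_plus, u_minus_1.
    unfold u. field. repeat split; auto.
  - apply u_neq_0.
  - fold e. rewrite u_minus_1_minus. apply Cmult_neq_0; auto.
  - fold e. rewrite u_minus_1_plus. apply Cmult_neq_0; auto.
Qed.

Lemma chi_orbit (k : nat) :
  chi A 1 (w k) = - (alpha / delta * (beta + INR k) / (q * (1 + INR k))).
Proof.
  rewrite orbit_half_plane. unfold A. rewrite chi_half_plane; try assumption.
  - fold e. rewrite u_minus_1_minus.
    replace (alpha / delta) with (/ (1 + e)).
    + unfold u. field. repeat split; auto.
    + rewrite RtoC_delta. unfold alpha. rewrite RtoC_qbN. field.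
      repeat split; assumption.
  - apply u_neq_0.
  - fold e. rewrite u_minus_1_minus. apply Cmult_neq_0; auto.
Qed.

Lemma orbit_series (x : C) :
  (Cmod x < q)%R ->
  exists F : C,
    is_hyp2F1 alpha beta delta (x / q) F /\
    is_series
      (fun k : nat =>
         chi A 1 (w k) * Cprod (fun m => psi A B 1 d (w m)) k * x ^ (S k))
      (1 - F).
Proof.
  intro hx.
  destruct (ex_hyp2F1 alpha beta delta (x / q)) as [F hF].
  - exact delta_pos.
  - rewrite Cmod_div, Cmod_R, Rabs_pos_eq by (assumption || lra).
    apply Rlt_div_l; lra.
  - exists F. split; [exact hF |].
    apply (is_series_ext (K := C_AbsRing) (V := C_NormedModule)
             (fun k => opp (hyp_term alpha beta delta (x / q) (S k)))).
    + intro k. rewrite chi_orbit. symmetry.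
      apply hypergeometric_coefficient; try assumption. exact psi_orbit.
    + replace (1 - F) with (opp (F - 1) : C) by (unfold opp; simpl; ring).
      apply (is_series_opp (K := C_AbsRing) (V := C_NormedModule)).
      apply (is_series_incr_1 (K := C_AbsRing) (V := C_NormedModule)).
      change (is_series (hyp_term alpha beta delta (x / q))
                (F - 1 + hyp_term alpha beta delta (x / q) 0)).
      replace (F - 1 + hyp_term alpha beta delta (x / q) 0) with F.
      * exact hF.
      * unfold hyp_term, poch; simpl. field.
Qed.

End Orbit.

Theorem theorem3p3 (phi : C -> C)
  (phi_lf : linear_fractional phi)
  (phi_disk : disk_self_map phi)
  (phi_nonaffine : ~ affine phi)
  (phi_nonautomorphic : ~ automorphic phi)
  (phi_fix1 : phi (RtoC 1) = RtoC 1) :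
  exists q : R,
    (0 < q)%R /\ is_derive phi (RtoC 1) (RtoC q) /\
    exists d : C,
      (1 < Cmod d)%R /\
      (forall z : C,
         phi z = ((1 + q + q * d) * z + (d - q - q * d)) / (z + d)) /\
      let A : C := 1 + q + q * d in
      let B : C := d - q - q * d in
      let N : R := (Cmod (1 + d) ^ 2)%R in
      let b : R := ((Cmod d ^ 2 - q * N - 1) / (q * N))%R in
      let alpha : C := (1 + d) / RtoC (q * b * N)%R in
      let beta : C := (d + d * Cconj d) / RtoC (q * b * N)%R in
      let delta : C := RtoC (1 / (q * b))%R in
      let w (k : nat) : C := Nat.iter k (tau A B 1 d) (phi 0) in
      forall x : C, (Cmod x < q)%R ->
        exists F : C,
          is_hyp2F1 alpha beta delta (x / q) F /\
          is_series
            (fun k : nat =>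
               chi A 1 (w k) * Cprod (fun m => psi A B 1 d (w m)) k * x ^ (S k))
            (1 - F).
Proof.
  destruct (non_affine_normal_form phi phi_lf phi_nonaffine phi_fix1)
    as [A [B [d [hdet [hsum [hd1 hphi]]]]]].
  destruct (self_map_parameters A B d hdet hsum hd1) as [q [hq [hA hle]]].
  { intros z hz. rewrite <- hphi. apply phi_disk, hz. }
  assert (hB : B = d - q - q * d).
  { replace B with (A + B - A) by ring. rewrite hsum, hA. ring. }
  subst A B.
  assert (hN : (0 < Cmod (1 + d) ^ 2)%R)
    by (apply pow_lt, Cmod_gt_0; exact hd1).
  assert (hd : (1 < Cmod d)%R) by (assert (h := Cmod_ge_0 d); nra).
  assert (hlt : (q * Cmod (1 + d) ^ 2 < Cmod d ^ 2 - 1)%R).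
  { destruct hle as [hlt | heq]; [exact hlt | exfalso].
    apply phi_nonautomorphic, (boundary_case_automorphic phi q d);
      auto. }
  exists q. split; [exact hq |]. split.
  { apply (is_derive_normal_form phi q d); assumption. }
  exists d. split; [exact hd |]. split; [exact hphi |].
  cbv zeta.
  replace (phi 0)
    with (lft (1 + q + q * d) (d - q - q * d) 1 d 0)
    by (rewrite hphi; unfold lft; rewrite Cmult_1_l; reflexivity).
  apply orbit_series; [exact hq | exact hd |].
  apply Rdiv_lt_0_compat; nra.
Qed.
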